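(* Let $\bar x\in\mathbb{R}^n$ and let $(\bar a,\bar u)\in P_{\bar x}\times\mathbb{R}^n$ be such that $\Phi(\bar x)=\xi_{\bar x}(\bar a,\bar u)$. Then the following conditions are equivalent: (i) $\bar x$ is a nonstationary point (i.e. not a stationary point) of the set optimization problem $\preceq^l\text{-}\min_{x\in\mathbb{R}^n}F(x)$; (ii) $\Phi(\bar x)<0$; (iii) $\bar u\neq0$.
   Context: $K\subseteq\mathbb{R}^m$ is a closed, convex, pointed ($K\cap(-K)=\{0\}$), solid ($\operatorname{int}K\neq\emptyset$) cone. For $y,z\in\mathbb{R}^m$: $y\preceq z$ iff $z-y\in K$, and $y\prec z$ iff $z-y\in\operatorname{int}(K)$. Standing assumption: $F(x)=\{f^1(x),\ldots,f^p(x)\}$ for $x\in\mathbb{R}^n$, where $f^1,\ldots,f^p:\mathbb{R}^n\to\mathbb{R}^m$ are twice continuously differentiable and $K$-strongly convex with respect to a common $e\in\operatorname{int}(K)$: there are $\rho_1,\ldots,\rho_p>0$ such that for every $i\in[p]=\{1,\ldots,p\}$, $x_1,x_2\in\mathbb{R}^n$, $\lambda\in[0,1]$, $f^i(\lambda x_1+(1-\lambda)x_2)\preceq\lambda f^i(x_1)+(1-\lambda)f^i(x_2)-\tfrac12\rho_i\lambda(1-\lambda)\|x_1-x_2\|^2e$. For $f^i=(f^{i,1},\ldots,f^{i,m})^\top$ and $u\in\mathbb{R}^n$, $\nabla f^i(x)^\top u\in\mathbb{R}^m$ denotes the Jacobian of $f^i$ at $x$ applied to $u$, and $u^\top\nabla^2f^i(x)u$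 denotes the vector $(u^\top\nabla^2f^{i,1}(x)u,\ldots,u^\top\nabla^2f^{i,m}(x)u)^\top\in\mathbb{R}^m$. Gerstewitz function: $\Psi_e(z)=\min\{t\in\mathbb{R}: te\in z+K\}$, $z\in\mathbb{R}^m$. $\operatorname{Min}(A,K)=\{z\in A:(z-K)\cap A=\{z\}\}$. $I(x)=\{i\in[p]:f^i(x)\in\operatorname{Min}(F(x),K)\}$; $w(x)=|\operatorname{Min}(F(x),K)|$; for $r\in\mathbb{R}^m$, $I_r(x)=\{i\in I(x):f^i(x)=r\}$. Fixing an enumeration $\{r_1^x,\ldots,r_{w(x)}^x\}$ of $\operatorname{Min}(F(x),K)$, the partition set at $x$ is $P_x=\prod_{j=1}^{w(x)}I_{r_j^x}(x)$; its elements are written $a=(a_1,\ldots,a_{w(x)})$. Stationary point: $\bar x$ is stationary if for every $a\in P_{\bar x}$ and every $u\in\mathbb{R}^n$ there exists $j\in[w(\bar x)]$ with $\nabla f^{a_j}(\bar x)^\top u\notin-\operatorname{int}(K)$ (equivalently $\Psi_e(\nabla f^{a_j}(\bar x)^\top u)\ge0$). For $x\in\mathbb{R}^n$, $a\in P_x$, $u\in\mathbb{R}^n$: $\xi_x(a,u)=\max_{j\in[w(x)]}\Psi_e\big(\nabla f^{a_j}(x)^\top u+\tfrac12u^\top\nabla^2f^{a_j}(x)u\big)$, and $\Phi(x)=\min_{(a,u)\in P_x\times\mathbb{R}^n}\xi_x(a,u)$. *)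

(* Defs.v *)
From HB Require Import structures.
From mathcomp Require Import all_boot all_order all_algebra finmap.
From mathcomp Require Import all_classical all_reals all_analysis.

Set Implicit Arguments.
Unset Strict Implicit.
Unset Printing Implicit Defensive.

Import Order.TTheory GRing.Theory Num.Theory.
Import numFieldNormedType.Exports.

Local Open Scope classical_set_scope.
Local Open Scope ring_scope.

(* Vectors of R^n are row vectors 'rV[R]_n. The library's norm on 'rV[R]_n is
   the sup norm; it is used only for the topology and for differentiability,
   and the Euclidean norm is [enorm]. *)

Section Extrema.
Context {R : realType}.
Implicit Type A : set R.

(* 0 if A has no least (resp. greatest) element *)
Definition set_min A : R := xget 0 [set t | A t /\ lbound A t].
Definition set_max A : R := xget 0 [set t | A t /\ ubound A t].

End Extrema.

Section Calculus.
Context {R : realType} {n m : nat}.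

Definition enorm (v : 'rV[R]_n) : R := Num.sqrt (\sum_k v 0 k ^+ 2).

(* The last clause is the continuity of the second Frechet derivative
   x |-> D('J g)(x), expressed pointwise in the direction v, which in finite
   dimension is continuity for the operator norm. *)
Definition twice_continuously_differentiable (g : 'rV[R]_n -> 'rV[R]_m) : Prop :=
  [/\ forall x, differentiable g x,
      forall x, differentiable (jacobian g) x &
      forall v, continuous (fun x => 'D_v (jacobian g) x)].

Definition hessian (h : 'rV[R]_n -> R) (x : 'rV[R]_n) : 'M[R]_n :=
  \matrix_(k, l)
    'D_(delta_mx 0 k : 'rV[R]_n) (fun y => 'D_(delta_mx 0 l : 'rV[R]_n) h y) x.

(* nabla g(x)^T u. The library's [jacobian] acts on rows, so 'J g x is the
   n x m matrix whose columns are the gradients of the components of g. *)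
Definition jac_app (g : 'rV[R]_n -> 'rV[R]_m) (x u : 'rV[R]_n) : 'rV[R]_m :=
  u *m 'J g x.

Definition hess_quad (g : 'rV[R]_n -> 'rV[R]_m) (x u : 'rV[R]_n) : 'rV[R]_m :=
  \row_k (u *m hessian (fun y => g y 0 k) x *m u^T) 0 0.

End Calculus.

Section Order.
Context {R : realType} {m : nat}.
Implicit Types (K A : set 'rV[R]_m) (e y z : 'rV[R]_m).

Record ordering_cone K : Prop := OrderingCone {
  oc_cone : forall (t : R) y, 0 <= t -> K y -> K (t *: y);
  oc_convex : convex_set (K : set (convex_lmodType 'rV[R]_m));
  oc_closed : closed K;
  oc_pointed : K `&` [set - y | y in K] = [set 0];
  oc_solid : K° !=set0 }.

Definition cone_le K y z : Prop := K (z - y).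

Definition Min A K : set 'rV[R]_m :=
  [set z | A z /\ [set z - k | k in K] `&` A = [set z]].

(* Gerstewitz function Psi_e *)
Definition gerstewitz K e z : R :=
  set_min [set t : R | [set z + k | k in K] (t *: e)].

Definition strongly_convex (n : nat) K e (rho : R) (g : 'rV[R]_n -> 'rV[R]_m) :=
  forall (x1 x2 : 'rV[R]_n) (l : R), 0 <= l <= 1 ->
    cone_le K (g (l *: x1 + (1 - l) *: x2))
      (l *: g x1 + (1 - l) *: g x2
       - (2^-1 * rho * l * (1 - l) * enorm (x1 - x2) ^+ 2) *: e).

End Order.

Section SetOptimization.
Context {R : realType} {n m p : nat}.
Variables (K : set 'rV[R]_m) (f : 'I_p -> 'rV[R]_n -> 'rV[R]_m).
Implicit Type x : 'rV[R]_n.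

Definition Fset x : set 'rV[R]_m := [set f i x | i in [set: 'I_p]].

Definition active x : set 'I_p := [set i | Min (Fset x) K (f i x)].

Definition active_at (r : 'rV[R]_m) x : set 'I_p :=
  [set i | active x i /\ f i x = r].

Definition width x : nat := #|` fset_set (Min (Fset x) K)|%fset.

Definition enumerates_Min (r : forall x, 'I_(width x) -> 'rV[R]_m) : Prop :=
  forall x, set_bij [set: 'I_(width x)] (Min (Fset x) K) (r x).

Variable r : forall x, 'I_(width x) -> 'rV[R]_m.

Definition partition_set x : set {ffun 'I_(width x) -> 'I_p} :=
  [set a | forall j, active_at (r j) x (a j)].
Arguments partition_set : clear implicits.

Definition stationary x : Prop :=
  forall a, partition_set x a -> forall u : 'rV[R]_n,
    exists j, ~ [set - y | y in K°] (jac_app (f (a j)) x u).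

Variable e : 'rV[R]_m.

Definition xi x (a : {ffun 'I_(width x) -> 'I_p}) (u : 'rV[R]_n) : R :=
  set_max [set gerstewitz K e
                 (jac_app (f (a j)) x u + 2^-1 *: hess_quad (f (a j)) x u)
          | j in [set: 'I_(width x)]].
Arguments xi : clear implicits.

Definition Phi x : R :=
  set_min [set xi x au.1 au.2 | au in partition_set x `*` [set: 'rV[R]_n]].

End SetOptimization.

Arguments partition_set {R n m p K f} r x _.
Arguments stationary {R n m p K f} r x.
Arguments xi {R n m p} K f e x a u.
Arguments Phi {R n m p K f} r e x.

(* Main.v *)
Require Import Defs.
From HB Require Import structures.
From mathcomp Require Import all_boot all_order all_algebra.
From mathcomp Require Import all_classical all_reals all_analysis.
From mathcomp Require Import ring lra.
Set Implicit Arguments.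
Unset Strict Implicit.
Unset Printing Implicit Defensive.
Import Order.TTheory GRing.Theory Num.Theory.
Import numFieldNormedType.Exports.
Local Open Scope classical_set_scope.
Local Open Scope ring_scope.

(* Everything rests on the characterization [Psi_e z <= t] iff [t e - z] in [K],
   which makes [Psi_e] sublinear, continuous, and negative exactly on [- int K].
   Passing to the limit in strong convexity gives the gradient inequality; adding
   it at x and at x + tu and letting t -> 0+ gives
   [u^T Hess f^i(x) u - rho_i |u|^2 e] in [K]. Hence the quadratic models are
   coercive, so the minimum defining [Phi] is attained and not a junk value;
   [Psi_e] of the gradient term lies below [Psi_e] of the model, so [Phi < 0] yields a
   descent direction; and halving u lowers a nonpositive model value by a multiple
   of |u|^2, so a minimizer u <> 0 has [Phi < 0]. Conversely a descent direction
   makes the models negative for short steps, and [xi(a, 0) = 0]. *)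

(** * The Gerstewitz function of a solid pointed cone *)

Section Cone.
Context {R : realType} {m : nat}.
Variables (K : set 'rV[R]_m) (hK : ordering_cone K).
Implicit Types (y z : 'rV[R]_m) (t : R).

Lemma cone0 : K 0.
Proof.
have [y /interior_subset Ky] := oc_solid hK.
by have := oc_cone hK (lexx 0) Ky; rewrite scale0r.
Qed.

(** The sum is twice the midpoint, which lies in [K] by convexity. *)
Lemma coneD y z : K y -> K z -> K (y + z).
Proof.
move=> Ky Kz.
have h0 : 0 <= 2^-1 :> R by lra.
have h1 : 2^-1 <= 1 :> R by lra.
have /(_ y z (Itv01 h0 h1)) := oc_convex hK.
rewrite !inE => /(_ Ky Kz).
move/(oc_cone hK (ler0n R 2)); rewrite /conv/= /unstable.onem scalerDr !scalerA.
by rewrite (_ : 2%:R * (1 - 2^-1) = 1 :> R) ?mulfV ?scale1r//; lra.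
Qed.

Lemma coneW y z : K y -> K (z - y) -> K z.
Proof. by move=> Ky Kz; rewrite -(subrK y z); exact: coneD. Qed.

Variables (e : 'rV[R]_m) (he : K° e).

(** [e] is an order unit: if the ball of radius [d] around [e] lies in [K], then with [C = 2 / d]
    the point [e - (C * |z|)^-1 *: z] is at distance [d / 2] from [e], and scaling gives the
    claim. *)
Lemma cone_bound : exists2 C, 0 < C & forall z, K ((C * `|z|) *: e - z).
Proof.
have := he; rewrite /interior => /nbhs_ballP[d /= d0 dK].
exists (2 / d) => [|z]; first by rewrite divr_gt0.
have [->|z0] := eqVneq z 0; first by rewrite normr0 mulr0 scale0r subrr; exact: cone0.
have Cz : 0 < 2 / d * `|z| by rewrite mulr_gt0 ?divr_gt0 ?normr_gt0.
have : K (e - (2 / d * `|z|)^-1 *: z).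
  apply: dK; rewrite -ball_normE /= opprB addrC subrK normrZ gtr0_norm ?invr_gt0//.
  by rewrite invfM invf_div -mulrA mulVf ?normr_eq0// mulr1; lra.
move/(oc_cone hK (ltW Cz)); rewrite scalerBr scalerA mulfV ?scale1r//.
exact: lt0r_neq0.
Qed.

Lemma interior_coneP z : K° z <-> exists2 t, 0 < t & K (z - t *: e).
Proof.
have [C C0 CK] := cone_bound; split.
  rewrite /interior => /nbhs_ballP[d /= d0 dK].
  (* The [1 +] keeps the denominator positive even if [e = 0]; [t *: e] then has norm below [d]. *)
  exists (d / (2 * (1 + `|e|))) => [|].
    by rewrite divr_gt0// mulr_gt0// ltr_pwDl.
  apply: dK; rewrite -ball_normE /= opprB addrC subrK normrZ.
  rewrite gtr0_norm ?divr_gt0 ?mulr_gt0 ?ltr_pwDl//.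
  rewrite -mulrA gtr_pMr// mulrC ltr_pdivrMr ?mulr_gt0 ?ltr_pwDl// mul1r.
  by have := normr_ge0 e; lra.
(* Within this radius [C * |z - y| < t], so [t *: e] absorbs the displacement [z - y]. *)
move=> [t t0 Kzt]; rewrite /interior; apply/nbhs_ballP; exists (t / C) => /=.
  exact: divr_gt0.
move=> y; rewrite -ball_normE /= => yz.
apply: (coneW Kzt); have -> : y - (z - t *: e) = t *: e - (z - y) by rewrite !opprB addrCA.
apply: (coneW (CK (z - y))); rewrite [- (_ - (z - y))]opprB subrKA -scalerBl.
apply: (oc_cone hK); last exact: interior_subset he.
by rewrite subr_ge0 mulrC -ler_pdivlMr// ltW.
Qed.

Hypothesis hm : (0 < m)%N.

(** If [t < 0], both [e] and [- e] lie in [K], so [e = 0]; then [cone_bound] makes [K] the whole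
    space, which pointedness forbids once [0 < m]. *)
Lemma cone_scale_ge0 t : K (t *: e) -> 0 <= t.
Proof.
have pointed y : K y -> K (- y) -> y = 0.
  move=> Ky KNy; have : (K `&` [set - x | x in K]) y.
    by split=> //; exists (- y); rewrite ?opprK.
  by rewrite (oc_pointed hK).
move=> Kt; rewrite leNgt; apply/negP => t0.
have Ke : K e by exact: interior_subset he.
have e0 : e = 0.
  apply: pointed => //.
  have : 0 <= - t^-1 by rewrite oppr_ge0 invr_le0 ltW.
  by move=> /(oc_cone hK)/(_ Kt); rewrite scalerA mulNr scaleNr mulVf ?ltr0_neq0// scale1r.
have [C _ CK] := cone_bound.
have allK z : K z by have := CK (- z); rewrite e0 scaler0 sub0r opprK.
have /rowP/(_ (Ordinal hm)) := pointed (const_mx 1) (allK _) (allK _).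
by rewrite !mxE => /eqP; rewrite oner_eq0.
Qed.

(** The set [S] of admissible [s] is upward closed, bounded below and closed, so [inf S] is its
    least element and [set_min] does not return its default. *)
Lemma gerstewitz_le z t : gerstewitz K e z <= t <-> K (t *: e - z).
Proof.
pose S := [set s : R | K (s *: e - z)].
have SE : [set s : R | [set z + k | k in K] (s *: e)] = S.
  apply/seteqP; split=> s /=; first by rewrite /S/= => -[k Kk <-]; rewrite addrC addKr.
  by move=> Ks; exists (s *: e - z) => //; rewrite addrC subrK.
have Sup s s' : s <= s' -> S s -> S s'.
  move=> ss' Ss; apply: (coneW Ss); rewrite opprB addrA subrK -scalerBl.
  by apply: (oc_cone hK); [rewrite subr_ge0|exact: interior_subset he].
have [C C0 CK] := cone_bound.
(* Adding [s *: e - z] and [(C * |z|) *: e + z] leaves a multiple of [e] in [K]. *)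
have Slb : lbound S (- (C * `|z|)).
  move=> s Ss; have := coneD Ss (CK (- z)).
  by rewrite opprK addrACA addNr addr0 -scalerDl normrN => /cone_scale_ge0; lra.
have Sinf : has_inf S.
  by split; [exists (C * `|z|); exact: CK|exists (- (C * `|z|))].
have Si : S (inf S).
  apply: (@closed_cvg _ _ (inf S)^'+ _ (fun s : R => s *: e - z) K (oc_closed hK)).
    near=> s.
    have : 0 < s - inf S by rewrite subr_gt0; near: s; exact: nbhs_right_gt.
    move=> /inf_adherent/(_ Sinf)[s' Ss']; rewrite addrC subrK => /ltW s's.
    exact: Sup s's Ss'.
  apply: cvg_at_right_filter; apply: cvgB; last exact: cvg_cst.
  by apply: cvgZr_tmp; exact: cvg_id.
rewrite /gerstewitz /set_min SE; case: xgetP => [s _ [Ss Sle]|/(_ (inf S))]; last first.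
  by case; split=> // s Ss; exact: (ge_inf Sinf.2 Ss).
by split=> [st|]; [exact: Sup st Ss|exact: Sle].
Unshelve. all: by end_near. Qed.

Lemma gerstewitz_self z : K (gerstewitz K e z *: e - z).
Proof. exact/gerstewitz_le. Qed.

Lemma gerstewitzD y z : gerstewitz K e (y + z) <= gerstewitz K e y + gerstewitz K e z.
Proof.
apply/gerstewitz_le; rewrite scalerDl opprD addrACA.
by apply: coneD; exact: gerstewitz_self.
Qed.

Lemma gerstewitzZ t z : 0 <= t -> gerstewitz K e (t *: z) <= t * gerstewitz K e z.
Proof.
move=> t0; apply/gerstewitz_le; rewrite -scalerA -scalerBr.
exact: (oc_cone hK) (gerstewitz_self z).
Qed.

Lemma gerstewitz0 : gerstewitz K e 0 = 0.
Proof.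
apply/eqP; rewrite eq_le; apply/andP; split.
  by apply/gerstewitz_le; rewrite scale0r subrr; exact: cone0.
by apply: cone_scale_ge0; have := gerstewitz_self 0; rewrite subr0.
Qed.

Lemma gerstewitz_lt0 z : gerstewitz K e z < 0 <-> K° (- z).
Proof.
split=> [z0|/interior_coneP[t t0]].
  apply/interior_coneP; exists (- gerstewitz K e z); first by rewrite oppr_gt0.
  by rewrite scaleNr opprK addrC; exact: gerstewitz_self.
rewrite addrC -scaleNr => /gerstewitz_le/le_lt_trans; apply.
by rewrite oppr_lt0.
Qed.

(** Subadditivity and [cone_bound] give the Lipschitz constant [C]. *)
Lemma gerstewitz_continuous : continuous (gerstewitz K e).
Proof.
have [C C0 CK] := cone_bound.
have lip y z : gerstewitz K e y <= gerstewitz K e z + C * `|y - z|.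
  by rewrite -{1}(subrK z y) addrC (le_trans (gerstewitzD _ _))// lerD2l; exact/gerstewitz_le.
move=> z; apply/(cvgrPdist_le (FF := nbhs_filter z)) => /= d d0.
apply: filterS (nbhsx_ballx z (d / C) (divr_gt0 d0 C0)) => y.
rewrite -ball_normE /= => /ltW; rewrite ler_pdivlMr// mulrC => zy.
have := lip y z; have := lip z y; rewrite (distrC y z) ler_norml; lra.
Qed.

End Cone.

(** * Bounds and continuity for matrix-valued maps *)

Section MatrixContinuity.
Context {R : realType}.

Lemma ler_mx_norm_coef (m n : nat) (A : 'M[R]_(m, n)) i j : `|A i j| <= `|A|.
Proof.
by rewrite [leRHS]/Num.Def.normr/= mx_normrE; exact: (le_bigmax _ _ (i, j)).
Qed.

Lemma mulmx_bound (m n : nat) (A : 'M[R]_(m, n)) :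
  exists2 M, 0 <= M & forall u : 'rV_m, `|u *m A| <= M * `|u|.
Proof.
exists (\sum_k `|row k A|) => [|u]; first exact: sumr_ge0.
rewrite mulmx_sum_row mulr_suml (le_trans (ler_norm_sum _ _ _))//.
by apply: ler_sum => k _; rewrite normrZ mulrC ler_wpM2l// ler_mx_norm_coef.
Qed.

Context {T : topologicalType}.

Lemma continuous_mx (m n : nat) (F : T -> 'M[R]_(m, n)) :
  (forall i j, continuous (fun x => F x i j)) -> continuous F.
Proof.
move=> cF x; apply/(cvgrPdist_le (FF := nbhs_filter x)) => d d0.
near=> y.
rewrite [leLHS]/Num.Def.normr/= mx_normrE (bigmax_le _ (ltW d0))//= => i _.
rewrite !mxE; move: i; near: y; apply: filter_forall => i.
exact: (cvgrPdist_le (FF := nbhs_filter x) _ _).1 (cF i.1 i.2 x) d d0.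
Unshelve. all: by end_near. Qed.

Lemma continuous_mulmx (l m n : nat) (F : T -> 'M[R]_(l, m)) (G : T -> 'M[R]_(m, n)) :
  continuous F -> continuous G -> continuous (fun x => F x *m G x).
Proof.
have entry p q (H : T -> 'M[R]_(p, q)) i j :
    continuous H -> continuous (fun x => H x i j).
  by move=> cH x; exact: continuous_comp (cH x) (@coord_continuous _ _ _ i j (H x)).
move=> cF cG; apply: continuous_mx => i j.
under eq_fun do rewrite mxE.
apply: continuous_big => [|k _ x]; first exact: add_continuous.
by apply: cvgM; [exact: entry|exact: entry].
Qed.

Lemma continuous_trmx (m n : nat) (F : T -> 'M[R]_(m, n)) :
  continuous F -> continuous (fun x => (F x)^T).
Proof.
move=> cF; apply: continuous_mx => i j; under eq_fun do rewrite mxE.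
move=> x; exact: continuous_comp (cF x) (@coord_continuous _ _ _ j i (F x)).
Qed.

End MatrixContinuity.

(** * Comparison of the sup norm with the Euclidean norm *)

Section EuclideanNorm.
Context {R : realType} {n : nat}.
Implicit Type u : 'rV[R]_n.

Lemma enorm_sqr u : enorm u ^+ 2 = \sum_k u 0 k ^+ 2.
Proof. by rewrite sqr_sqrtr// sumr_ge0// => k _; exact: sqr_ge0. Qed.

Lemma enorm_sqrZ (t : R) u : enorm (t *: u) ^+ 2 = t ^+ 2 * enorm u ^+ 2.
Proof. by rewrite !enorm_sqr mulr_sumr; apply: eq_bigr => k _; rewrite mxE exprMn. Qed.

Lemma norm_le_enorm u : `|u| ^+ 2 <= enorm u ^+ 2.
Proof.
rewrite [`|u|]/Num.Def.normr/=.
have [->|/mx_norm_neq0[[i k] ->]/=] := eqVneq (mx_norm u) 0.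
  by rewrite expr0n/= sqr_ge0.
rewrite real_normK ?num_real// enorm_sqr (bigD1 k)//= ord1.
by rewrite lerDl sumr_ge0// => l _; exact: sqr_ge0.
Qed.

End EuclideanNorm.

(** * First- and second-order consequences of strong convexity *)

Section SecondOrder.
Context {R : realType} {n m : nat}.
Variable g : 'rV[R]_n -> 'rV[R]_m.
Implicit Types x u v : 'rV[R]_n.

(** The entries of the Jacobian are the first partial derivatives, so the entrywise Hessians are
    directional derivatives of [jacobian g]; linearity in the direction sums them to ['D_u]. *)
Lemma hess_quadE x u : (forall y, differentiable g y) ->
  differentiable (jacobian g) x ->
  hess_quad g x u = u *m 'D_u (jacobian g) x.
Proof.
move=> dg dJ; apply/rowP => c; rewrite !mxE.
have dE l : (fun y => 'D_('e_l) (fun z => g z 0 c) y) = (fun y => jacobian g y l c).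
  apply/funext => y; transitivity (row l (jacobian g y) 0 c); last by rewrite mxE.
  by rewrite rowE -deriveEjacobian// derive_mx ?mxE//; exact: diff_derivable.
have hE k l : hessian (fun y => g y 0 c) x k l = ('D_('e_k) (jacobian g) x) l c.
  by rewrite mxE dE derive_mx ?mxE//; exact: diff_derivable.
apply: eq_bigr => l _; rewrite mulrC !mxE; congr (_ * _).
rewrite deriveE// {2}(row_sum_delta u) linear_sum summxE.
by apply: eq_bigr => k _; rewrite hE deriveE// linearZ mxE.
Qed.

Variables (K : set 'rV[R]_m) (hK : ordering_cone K) (e : 'rV[R]_m) (rho : R).
Hypothesis hconv : strongly_convex K e rho g.

(** Strong convexity between [x + v] and [x] with weight [l] is divided by [l]; as [l] tends to 0
    from the right the difference quotient converges, and [K] is closed. *)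
Lemma strongly_convex_gradient x v : differentiable g x ->
  K (g (x + v) - g x - v *m jacobian g x - (2^-1 * rho * enorm v ^+ 2) *: e).
Proof.
move=> dg.
apply: (@closed_cvg _ _ (0 : R)^'+ _
  (fun l : R => g (x + v) - g x - l^-1 *: (g (l *: v + x) - g x) -
             (2^-1 * rho * (1 - l) * enorm v ^+ 2) *: e) K (oc_closed hK)).
  near=> l.
  have l0 : 0 < l by near: l; exact: nbhs_right_gt.
  have l1 : l < 1 by near: l; exact: nbhs_right_lt.
  have := hconv (x + v) x (l := l); rewrite /cone_le !ltW// => /(_ isT).
  have li : 0 <= l^-1 by rewrite invr_ge0 ltW.
  move/(oc_cone hK li).
  have -> : l *: (x + v) + (1 - l) *: x = l *: v + x.
    by apply/rowP => i; rewrite !mxE; ring.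
  rewrite [x + v - x]addrAC subrr add0r; congr K.
  by apply/rowP => i; rewrite !mxE; field; rewrite gt_eqF.
apply: cvgB; last first.
  apply: cvgZr_tmp.
  have : 2^-1 * rho * (1 - l) * enorm v ^+ 2 @[l --> (0 : R)] -->
         2^-1 * rho * (1 - 0) * enorm v ^+ 2.
    apply: cvgM; last exact: cvg_cst.
    apply: cvgM; first exact: cvg_cst.
    by apply: cvgB; [exact: cvg_cst|exact: cvg_id].
  by rewrite subr0 mulr1 => /cvg_at_right_filter.
apply: cvgB; first exact: cvg_cst.
apply: cvg_dnbhs_at_right; rewrite -deriveEjacobian//.
exact: diff_derivable.
Unshelve. all: by end_near. Qed.

(** In the sum of the two gradient inequalities the values of [g] cancel and the two halves of [rho]
    add up. What remains is of order [t ^+ 2], hence the factor [t^-1 * t^-1]. *)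
Lemma strongly_convex_hess x u : (forall y, differentiable g y) ->
  differentiable (jacobian g) x ->
  K (hess_quad g x u - (rho * enorm u ^+ 2) *: e).
Proof.
move=> dg dJ; rewrite hess_quadE//.
apply: (@closed_cvg _ _ (0 : R)^'+ _
  (fun t : R => u *m (t^-1 *: (jacobian g (t *: u + x) - jacobian g x)) -
             (rho * enorm u ^+ 2) *: e) K (oc_closed hK)).
  near=> t.
  have t0 : 0 < t by near: t; exact: nbhs_right_gt.
  have ti : 0 <= t^-1 * t^-1 by rewrite mulr_ge0// invr_ge0 ltW.
  (* [strongly_convex_gradient] from x to x + tu and back, added. *)
  have combine (N : R) (a b c d : 'rV[R]_m) : (t^-1 * t^-1) *:
      (c - d - t *: a - (2^-1 * rho * (t ^+ 2 * N)) *: e +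
       (d - c - (- t) *: b - (2^-1 * rho * ((- t) ^+ 2 * N)) *: e)) =
      t^-1 *: (b - a) - (rho * N) *: e.
    by apply/rowP => i; rewrite !mxE; field; rewrite gt_eqF.
  have := coneD hK (strongly_convex_gradient (t *: u) (dg x))
                (strongly_convex_gradient (- (t *: u)) (dg (x + t *: u))).
  rewrite addrK -[- (t *: u)]scaleNr !enorm_sqrZ -!scalemxAl -scalemxAr mulmxBr.
  by rewrite [t *: u + x]addrC => /(oc_cone hK ti); rewrite combine.
apply: cvgB; last exact: cvg_cst.
apply: cvg_dnbhs_at_right.
apply: continuous_cvg; last exact: diff_derivable.
by apply: continuous_mulmx; [exact: cst_continuous|move=> A].
Unshelve. all: by end_near. Qed.

End SecondOrder.

(** * Maxima of finite families *)

Section FiniteMax.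
Context {R : realType} {w : nat}.
Implicit Types (h : 'I_w -> R) (j : 'I_w).

(** The index [j0] makes the family nonempty, which rules out the default value of [set_max]. *)
Lemma set_max_attained h (j0 : 'I_w) (M := set_max [set h j | j in [set: 'I_w]]) :
  (exists j, M = h j) /\ forall j, h j <= M.
Proof.
rewrite /M /set_max; case: xgetP => [_ -> [[j _ <-] ub]|].
  by split=> [|k]; [exists j|apply: ub; exists k].
case: (@Order.TotalTheory.arg_maxP _ _ _ j0 predT h isT) => j _ jmax.
move=> /(_ (h j)); case; split; first by exists j.
by move=> _ [k _ <-]; exact: jmax.
Qed.

Lemma set_max_le h (j0 : 'I_w) t :
  set_max [set h j | j in [set: 'I_w]] <= t <-> forall j, h j <= t.
Proof.
have [[k kE] ub] := set_max_attained h j0; split=> [ht j|ht].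
  exact: le_trans (ub j) ht.
by rewrite kE.
Qed.

Lemma set_max_lt h (j0 : 'I_w) t :
  set_max [set h j | j in [set: 'I_w]] < t <-> forall j, h j < t.
Proof.
have [[k kE] ub] := set_max_attained h j0; split=> [ht j|ht].
  exact: le_lt_trans (ub j) ht.
by rewrite kE.
Qed.

Lemma continuous_set_max {T : topologicalType} (H : 'I_w -> T -> R) (j0 : 'I_w) :
  (forall j, continuous (H j)) ->
  continuous (fun x => set_max [set H j x | j in [set: 'I_w]]).
Proof.
move=> cH x; apply/(cvgrPdist_le (FF := nbhs_filter x)) => d d0; near=> y.
have dist j : `|H j x - H j y| <= d.
  move: j; near: y; apply: filter_forall => j.
  exact: (cvgrPdist_le (FF := nbhs_filter x) _ _).1 (cH j x) d d0.
have [_ ubx] := set_max_attained (H^~ x) j0.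
have [_ uby] := set_max_attained (H^~ y) j0.
rewrite ler_distlC; apply/andP; split.
  rewrite lerBlDr; apply/(set_max_le _ j0) => j.
  by have := dist j; have := uby j; rewrite ler_norml; lra.
apply/(set_max_le _ j0) => j.
by have := dist j; have := ubx j; rewrite ler_norml; lra.
Unshelve. all: by end_near. Qed.

End FiniteMax.

(** * Attained minima and minimal elements *)

Lemma set_min_eq {R : realType} (A : set R) t : A t -> lbound A t -> set_min A = t.
Proof.
move=> At tA; rewrite /set_min; case: xgetP => [_ -> [As sA]|/(_ t)]; last by case.
by apply/eqP; rewrite eq_le tA// (sA t).
Qed.

(* A minimal element: f^i(x) with the fewest indices k such that f^k(x) lies below it. *)
Lemma Min_nonempty {R : realType} (n m p : nat) (K : set 'rV[R]_m)
    (f : 'I_p -> 'rV[R]_n -> 'rV[R]_m) x :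
  ordering_cone K -> (0 < p)%N -> Min (Fset f x) K !=set0.
Proof.
move=> hK hp.
pose below i : {set 'I_p} := [set k | `[< K (f i x - f k x) >]]%SET.
case: (@arg_minnP _ (Ordinal hp) predT (fun i => #|below i|) isT) => i _ imin.
exists (f i x); split; first by exists i.
apply/seteqP; split=> [_ [[k Kk <-] [j _ jE]]|_ -> /=]; last first.
  by split; [exists 0; [exact: (cone0 hK)|rewrite subr0]|exists i].
have Kij : K (f i x - f j x) by rewrite jE opprB addrC subrK.
(* By transitivity; minimal cardinality then forces equality, so [i] is in [below j] and pointedness
   identifies the two values. *)
have ji : below j \subset below i.
  apply/fintype.subsetP => l; rewrite !inE => Kjl.
  by rewrite -(subrK (f j x) (f i x)) -addrA; exact: (coneD hK).
have /eqP/setP/(_ i) : below j == below i by rewrite eqEcard ji imin.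
rewrite !inE subrr; case: asboolP => [Kji _|_ /esym/asboolP]; last first.
  by case; exact: (cone0 hK).
have : (K `&` [set - y | y in K]) (f i x - f j x).
  by split=> //; exists (f j x - f i x); rewrite ?opprB.
by rewrite (oc_pointed hK) -jE /= => /eqP; rewrite subr_eq0 => /eqP ->.
Qed.

(** * The quadratic model of one objective *)

Section Model.
Context {R : realType} {n m : nat}.
Variables (g : 'rV[R]_n -> 'rV[R]_m) (x : 'rV[R]_n).
Implicit Type u : 'rV[R]_n.

Definition quad_model u : 'rV[R]_m := jac_app g x u + 2^-1 *: hess_quad g x u.

Lemma jac_appZ (t : R) u : jac_app g x (t *: u) = t *: jac_app g x u.
Proof. by rewrite /jac_app scalemxAl. Qed.

Lemma hess_quadZ (t : R) u : hess_quad g x (t *: u) = t ^+ 2 *: hess_quad g x u.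
Proof.
apply/rowP => k; rewrite [LHS]mxE [RHS]mxE [X in _ * X]mxE.
by rewrite [(t *: u)^T]linearZ/= -scalemxAr -!scalemxAl scalerA -expr2 [LHS]mxE.
Qed.

Lemma quad_model0 : quad_model 0 = 0.
Proof.
by rewrite /quad_model -(scale0r 0) jac_appZ hess_quadZ expr0n/= !scale0r scaler0 addr0.
Qed.

Lemma quad_model_continuous : continuous quad_model.
Proof.
have c1 : continuous (fun u : 'rV[R]_n => u) by move=> u.
have ccst k l (A : 'M[R]_(k, l)) : continuous (fun _ : 'rV[R]_n => A).
  exact: cst_continuous.
have cJ : continuous (jac_app g x) by apply: continuous_mulmx.
have cH : continuous (hess_quad g x).
  apply: continuous_mx => i k; under eq_fun do rewrite mxE.
  have cM : continuous (fun u => u *m hessian (fun y => g y 0 k) x *m u^T).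
    by apply: continuous_mulmx; [exact: continuous_mulmx|exact: continuous_trmx].
  move=> u; exact: continuous_comp (cM u) (@coord_continuous _ _ _ 0 0 _).
by move=> u; exact: cvgD (cJ u) (cvgZl_tmp (cH u)).
Qed.

Variables (hm : (0 < m)%N) (K : set 'rV[R]_m) (hK : ordering_cone K).
Variables (e : 'rV[R]_m) (he : K° e).

Lemma quad_model_descent u : gerstewitz K e (jac_app g x u) < 0 ->
  \forall t \near (0 : R)^'+, gerstewitz K e (quad_model (t *: u)) < 0.
Proof.
move=> J0; set s := gerstewitz K e (hess_quad g x u).
(* Below this threshold the linear term in [t] dominates [2^-1 * t ^+ 2 * s]; the [1 +] covers
   [s = 0]. *)
have b0 : 0 < - 2 * gerstewitz K e (jac_app g x u) / (1 + `|s|).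
  by rewrite divr_gt0 ?ltr_pwDl//; lra.
near=> t.
have t0 : 0 < t by near: t; exact: nbhs_right_gt.
have : t < - 2 * gerstewitz K e (jac_app g x u) / (1 + `|s|).
  by near: t; exact: nbhs_right_lt.
rewrite ltr_pdivlMr ?ltr_pwDl// => tb.
rewrite /quad_model jac_appZ hess_quadZ scalerA.
apply: le_lt_trans (gerstewitzD hK he hm _ _) _.
have := gerstewitzZ hK he hm (jac_app g x u) (ltW t0).
have t2 : 0 <= 2^-1 * t ^+ 2 by rewrite mulr_ge0// sqr_ge0.
have := gerstewitzZ hK he hm (hess_quad g x u) t2; rewrite -/s.
have := ler_norm s; nra.
Unshelve. all: by end_near. Qed.

Variable rho : R.
Hypothesis rho0 : 0 < rho.
Hypothesis hess_ge : forall u, K (hess_quad g x u - (rho * enorm u ^+ 2) *: e).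

(** Half of [hess_ge] is added to the membership characterizing [gerstewitz] of the model. *)
Lemma jac_app_le_quad_model u :
  gerstewitz K e (jac_app g x u) + 2^-1 * rho * enorm u ^+ 2 <=
  gerstewitz K e (quad_model u).
Proof.
rewrite -lerBrDr; apply/(gerstewitz_le hK he hm).
have h2 : 0 <= 2^-1 :> R by [].
have := coneD hK (gerstewitz_self hK he hm (quad_model u))
                 (oc_cone hK h2 (hess_ge u)).
move: (gerstewitz K e (quad_model u)) => s; rewrite /quad_model.
move: (jac_app g x u) (hess_quad g x u) => a b.
by congr K; apply/rowP => i; rewrite !mxE; field.
Qed.

(** The model at [u / 2] has one eighth of the Hessian term, half the model at [u] has one quarter;
    the missing eighth is bounded below by [hess_ge]. *)
Lemma quad_model_half u :
  gerstewitz K e (quad_model (2^-1 *: u)) <=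
  2^-1 * gerstewitz K e (quad_model u) - 8^-1 * rho * enorm u ^+ 2.
Proof.
apply/(gerstewitz_le hK he hm).
have h2 : 0 <= 2^-1 :> R by [].
have h8 : 0 <= 8^-1 :> R by [].
have := coneD hK (oc_cone hK h2 (gerstewitz_self hK he hm (quad_model u)))
                 (oc_cone hK h8 (hess_ge u)).
move: (gerstewitz K e (quad_model u)) => s; rewrite /quad_model jac_appZ hess_quadZ.
move: (jac_app g x u) (hess_quad g x u) => a b.
by congr K; apply/rowP => i; rewrite !mxE; field.
Qed.

Lemma quad_model_coercive :
  exists B, forall u, gerstewitz K e (quad_model u) <= 0 -> `|u| <= B.
Proof.
have [C C0 CK] := cone_bound hK he.
have [M M0 JM] := mulmx_bound (jacobian g x).
(* A nonpositive model value gives [2^-1 * rho * |u| ^+ 2 <= C * M * |u|]. *)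
exists (2 * C * M / rho) => u qu.
have [->|u0] := eqVneq u 0; first by rewrite normr0 divr_ge0 ?mulr_ge0// ltW.
rewrite ler_pdivlMr//.
have J : - (C * `|jac_app g x u|) <= gerstewitz K e (jac_app g x u).
  have := coneD hK (gerstewitz_self hK he hm (jac_app g x u)) (CK (- jac_app g x u)).
  rewrite opprK addrACA addNr addr0 -scalerDl normrN.
  by move/(cone_scale_ge0 hK he hm); lra.
have U0 : 0 < `|u| by rewrite normr_gt0.
rewrite -(ler_pM2r U0).
have CJ := ler_wpM2l (ltW C0) (JM u : `|jac_app g x u| <= _).
have UE := ler_wpM2l (ltW rho0) (norm_le_enorm u).
have := jac_app_le_quad_model u.
by nra.
Qed.

End Model.

(** * Attainment of the minimum defining [Phi] *)

Section SetOptimization.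
Context {R : realType} {n m p : nat}.
Variable hm : (0 < m)%N.
Variables (K : set 'rV[R]_m) (hK : ordering_cone K).
Variables (e : 'rV[R]_m) (he : K° e).
Variables (f : 'I_p -> 'rV[R]_n -> 'rV[R]_m) (rho : 'I_p -> R).
Variable x : 'rV[R]_n.
Hypothesis rho0 : forall i, 0 < rho i.
Hypothesis hess_ge : forall i u,
  K (hess_quad (f i) x u - (rho i * enorm u ^+ 2) *: e).
Variable j0 : 'I_(width K f x).
Implicit Types (a : {ffun 'I_(width K f x) -> 'I_p}) (u : 'rV[R]_n).

Lemma xi_lt0 a u : xi K f e x a u < 0 <->
  forall j, gerstewitz K e (quad_model (f (a j)) x u) < 0.
Proof. exact: set_max_lt j0 _. Qed.

Lemma xi_le0 a u : xi K f e x a u <= 0 <->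
  forall j, gerstewitz K e (quad_model (f (a j)) x u) <= 0.
Proof. exact: set_max_le j0 _. Qed.

Lemma xi0 a : xi K f e x a 0 = 0.
Proof.
have [[j jE] _] := set_max_attained
  (fun j => gerstewitz K e (quad_model (f (a j)) x 0)) j0.
by rewrite /xi jE quad_model0 gerstewitz0.
Qed.

Lemma xi_continuous a : continuous (xi K f e x a).
Proof.
apply: (continuous_set_max j0) => j u.
apply: continuous_comp; first exact: quad_model_continuous.
exact: gerstewitz_continuous.
Qed.

(** The sublevel set [A] contains 0 and is compact, coercivity of the single component [j0]
    sufficing to bound it; off [A] the values are positive. *)
Lemma xi_min a : exists u, forall v, xi K f e x a u <= xi K f e x a v.
Proof.
pose A := [set u | xi K f e x a u <= 0].
have A0 : A 0 by rewrite /A /= xi0.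
have [B uB] := quad_model_coercive hm hK he (rho0 (a j0)) (hess_ge (a j0)).
have Abd : bounded_set A.
  exists B; split; first exact: num_real.
  by move=> b Bb u /xi_le0/(_ j0)/uB/le_trans; apply; exact: ltW.
have Acl : closed A.
  apply: (@preimage_closed _ _ (xi K f e x a) [set t | t <= 0]).
    by move=> u _; exact: xi_continuous.
  exact: closed_le.
have [||u /set_mem Au umin] :=
    @EVT_min_rV _ _ (xi K f e x a) A _ (bounded_closed_compact Abd Acl).
- by exists 0.
- by apply: continuous_subspaceT; exact: xi_continuous.
exists u => v; have [v0|/ltW v0] := lerP (xi K f e x a v) 0.
  by apply: umin; exact/mem_set.
exact: le_trans v0.
Qed.

(** Only finitely many [a] exist: the best of their minimizers [uof a] over the partition set
    attains the joint minimum. *)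
Lemma Phi_le (r : forall x, 'I_(width K f x) -> 'rV[R]_m) a u :
  partition_set r x a -> Phi r e x <= xi K f e x a u.
Proof.
move=> Pa.
have [uof uofP] := choice xi_min.
have := @arg_minP _ _ _ a (fun b => `[< partition_set r x b >])
   (fun b => xi K f e x b (uof b)) (introT (asboolP _) Pa).
case=> b /asboolP Pb bmin.
have lb c v : partition_set r x c -> xi K f e x b (uof b) <= xi K f e x c v.
  by move=> Pc; rewrite (le_trans _ (uofP c v))// bmin//; exact/asboolP.
rewrite /Phi (@set_min_eq _ _ (xi K f e x b (uof b))) ?lb//.
  by exists (b, uof b).
by move=> _ [[c v] [/= Pc _] <-]; exact: lb.
Qed.

End SetOptimization.

Theorem theorem4p1 (R : realType) (n m p : nat) (hm : (0 < m)%N) (hp : (0 < p)%N)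
  (K : set 'rV[R]_m) (hK : ordering_cone K)
  (e : 'rV[R]_m) (he : K° e)
  (f : 'I_p -> 'rV[R]_n -> 'rV[R]_m)
  (hf : forall i, twice_continuously_differentiable (f i))
  (rho : 'I_p -> R) (hrho : forall i, 0 < rho i)
  (hconv : forall i, strongly_convex K e (rho i) (f i))
  (r : forall x, 'I_(width K f x) -> 'rV[R]_m) (hr : enumerates_Min r)
  (xbar : 'rV[R]_n) (abar : {ffun 'I_(width K f xbar) -> 'I_p}) (ubar : 'rV[R]_n)
  (habar : partition_set r xbar abar)
  (hmin : Phi r e xbar = xi K f e xbar abar ubar) :
  (~ stationary r xbar <-> Phi r e xbar < 0) /\
  (Phi r e xbar < 0 <-> ubar <> 0).
Proof.
have hess_ge i u : K (hess_quad (f i) xbar u - (rho i * enorm u ^+ 2) *: e).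
  by have [dg dJ _] := hf i; exact: strongly_convex_hess (hconv i) _ _ dg (dJ _).
have [z zMin] := Min_nonempty f xbar hK hp.
(* Surjectivity of the enumeration turns a minimal element into an index. *)
have [_ _ /(_ z zMin)[j0 _ _]] := hr xbar.
have PhiP := Phi_le hm hK he hrho hess_ge j0.
have xiP := xi_lt0 e j0.
have descent a u : partition_set r xbar a ->
    (forall j, gerstewitz K e (jac_app (f (a j)) xbar u) < 0) -> Phi r e xbar < 0.
  move=> Pa Ju.
  (* As there are finitely many [j], one step length serves them all. *)
  have : \forall t \near (0 : R)^'+, forall j,
      gerstewitz K e (quad_model (f (a j)) xbar (t *: u)) < 0.
    by apply: filter_forall => j; exact: quad_model_descent.
  by move=> /filter_ex[t /xiP]; exact: le_lt_trans (PhiP _ _ _ Pa).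
have intE y : [set - z | z in K°] y <-> gerstewitz K e y < 0.
  rewrite (gerstewitz_lt0 hK he hm); split=> [[w Kw <-]|Ky]; first by rewrite opprK.
  by exists (- y); rewrite ?opprK.
split; split.
- move=> /existsNP[a /not_implyP[Pa /existsNP[u /forallNP Ju]]].
  by apply: (descent a u Pa) => j; apply/intE; apply: contrapT; exact: Ju.
(* The minimizer [ubar] itself violates stationarity for [abar]. *)
- rewrite hmin => /xiP qlt /(_ abar habar ubar)[j]; apply; apply/intE.
  apply: le_lt_trans (qlt j).
  apply: le_trans (jac_app_le_quad_model hm hK he (hess_ge (abar j)) ubar).
  by rewrite lerDl mulr_ge0 ?sqr_ge0// mulr_ge0// ltW.
- by rewrite hmin => + ubar0; rewrite ubar0 xi0// ltxx.
move=> /eqP ubar0; rewrite lt_neqAle; apply/andP; split; last first.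
  by rewrite -(xi0 hm hK he j0 abar); exact: PhiP.
apply/eqP => Phi0.
have ubar_gt0 : 0 < enorm ubar ^+ 2.
  by apply: lt_le_trans (norm_le_enorm ubar); rewrite exprn_gt0// normr_gt0.
(* If [Phi] were 0, the half step would give a strictly negative value, below the minimum. *)
suff /xiP/(le_lt_trans (PhiP _ abar (2^-1 *: ubar) habar)) :
    forall j, gerstewitz K e (quad_model (f (abar j)) xbar (2^-1 *: ubar)) < 0.
  by rewrite Phi0 ltxx.
have q0 : xi K f e xbar abar ubar <= 0 by rewrite -hmin Phi0.
move=> j; have qj := (xi_le0 e j0 _ _).1 q0 j.
have := quad_model_half hm hK he (hess_ge (abar j)) ubar.
have : 0 < rho (abar j) * enorm ubar ^+ 2 by rewrite mulr_gt0.
lra.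
Qed.
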